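(* Let $f:\mathbb{Z}^2\to[0,1]$ be a function such that for all $(i,j)\in\mathbb{Z}^2$ $$f(i,j)=\frac14\Bigl(f(i-1,j)+f(i+1,j)+f(i,j-1)+f(i,j+1)\Bigr).$$ Then $f$ is constant.
   Context: The squares of the integer lattice in the plane are labeled by their lower-left vertices $(i,j)\in\mathbb{Z}^2$, and $f(i,j)$ is the number written into the square $(i,j)$. The four neighbors of the square $(i,j)$ are the squares $(i\pm1,j)$ and $(i,j\pm1)$. *)

(* Defs.v *)
From HB Require Import structures.
From mathcomp Require Import all_boot all_order all_algebra.
From mathcomp Require Import reals.

Set Implicit Arguments.
Unset Strict Implicit.
Unset Printing Implicit Defensive.

(* Main.v *)
Require Import Defs.
From HB Require Import structures.
From mathcomp Require Import all_boot all_order all_algebra.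
From mathcomp Require Import reals.
From mathcomp Require Import classical_sets ring lra.

Set Implicit Arguments.
Unset Strict Implicit.
Unset Printing Implicit Defensive.

Import Order.TTheory GRing.Theory Num.Theory.
Local Open Scope ring_scope.

(** Let M be the supremum of the increments g(i,j) = f(i+1,j) - f(i,j), which
    again have the mean value property.  If g(p) >= M - e, then g >= M - 4e at
    each neighbour of p.  So if M > 0, then g >= M/2 along arbitrarily long
    horizontal runs that start at a point where g is close enough to M, and f
    grows by more than 1 along such a run.  Hence M <= 0; applying this to
    1 - f and to the transpose of f shows that f is constant. *)

Definition harmonic (R : realType) (f : int * int -> R) : Prop :=
  forall i j : int,
    f (i, j) = 4^-1 * (f (i - 1, j) + f (i + 1, j)
                       + f (i, j - 1) + f (i, j + 1)).

Lemma harmonic_increment (R : realType) (f : int * int -> R) :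
  harmonic f -> harmonic (fun p => f (p.1 + 1, p.2) - f p).
Proof.
move=> f_mean i j /=.
(* Both terms of the increment are averaged; [i + 1 - 1] and [i - 1 + 1] must both become [i] before
   the two sides agree as polynomials. *)
rewrite [in LHS]f_mean [X in _ - X = _]f_mean addrK subrK; ring.
Qed.

(** The right neighbour equals four times the centre minus the other three neighbours, each at most
    [M], so a step to the right at most quadruples the deficit from [M]. *)
Lemma harmonic_near_bound (R : realType) (g : int * int -> R) (M e : R)
    (i j : int) :
  harmonic g -> (forall p, g p <= M) -> M - e <= g (i, j) ->
  forall k : nat, M - 4 ^+ k * e <= g (i + k%:Z, j).
Proof.
move=> g_mean gM ge; elim=> [|k IHk]; first by rewrite addr0 expr0 mul1r.
have := g_mean (i + k%:Z) j.
rewrite -(addn1 k) PoszD addrA exprD expr1.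
have := gM (i + k%:Z - 1, j); have := gM (i + k%:Z, j - 1).
have := gM (i + k%:Z, j + 1); lra.
Qed.

Lemma harmonic_nonincreasing (R : realType) (f : int * int -> R) :
  (forall i j, 0 <= f (i, j) <= 1) -> harmonic f ->
  forall i j, f (i + 1, j) <= f (i, j).
Proof.
move=> f_range f_mean i0 j0; rewrite leNgt; apply/negP => f_lt.
pose g p := f (p.1 + 1, p.2) - f p.
have supE : has_sup (range g).
  split; first by exists (g (i0, j0)), (i0, j0).
  exists 1 => _ [[i j] _ <-]; rewrite /g /=.
  by have := f_range i j; have := f_range (i + 1) j; lra.
set M := sup (range g).
have gM p : g p <= M by apply: sup_upper_bound => //; exists p.
have M_gt0 : 0 < M by apply: lt_le_trans (gM (i0, j0)); rewrite subr_gt0.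
(* A run of [n] increments, each at least [M / 2], overshoots the width 1 of the range of [f]. *)
have [n ltn] : exists n : nat, 1 < n%:R * (M / 2).
  exists (Num.bound (M / 2)^-1); rewrite -ltr_pdivrMr ?divr_gt0// mul1r.
  by apply: le_lt_trans (archi_boundP _); rewrite ?invr_ge0 ?divr_ge0// ltW.
(* Even after [n] quadruplings, a deficit of [e] is only [M / 2]. *)
pose e := M / 2 / 4 ^+ n.
have e_gt0 : 0 < e by rewrite !divr_gt0// exprn_gt0.
have [_ [[i j] _ <-] ge] := sup_adherent e_gt0 supE.
have g_run k : (k <= n)%N -> M / 2 <= g (i + k%:Z, j).
  move=> le_kn.
  apply: le_trans
    (harmonic_near_bound (harmonic_increment f_mean) gM (ltW ge) k).
  have : 4 ^+ k * e <= M / 2.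
    rewrite /e mulrCA ler_piMr ?divr_ge0 ?(ltW M_gt0)//.
    by rewrite ler_pdivrMr ?exprn_gt0// mul1r ler_eXn2l// ltr1n.
  by lra.
have f_run k : (k <= n)%N -> f (i, j) + k%:R * (M / 2) <= f (i + k%:Z, j).
  elim: k => [|k IHk] lt_kn; first by rewrite addr0 mul0r addr0.
  have := IHk (ltnW lt_kn); have := g_run k (ltnW lt_kn).
  by rewrite /g /= -(addn1 k) PoszD addrA natrD; lra.
have := f_run n (leqnn n).
by have := f_range i j; have := f_range (i + n%:Z) j; lra.
Qed.

Lemma harmonic_horizontal (R : realType) (f : int * int -> R) :
  (forall i j, 0 <= f (i, j) <= 1) -> harmonic f ->
  forall i j, f (i + 1, j) = f (i, j).
Proof.
move=> f_range f_mean i j; apply/le_anti/andP; split.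
  exact: harmonic_nonincreasing.
(* Reflection preserves both the range and the mean value property, and it reverses the
   inequality. *)
have : 1 - f (i + 1, j) <= 1 - f (i, j).
  apply: (@harmonic_nonincreasing R (fun p => 1 - f p)) => k l.
    by have := f_range k l; lra.
  by rewrite [in LHS]f_mean; lra.
by lra.
Qed.

Lemma int_shift_invariant (T : Type) (h : int -> T) :
  (forall i, h (i + 1) = h i) -> forall i, h i = h 0.
Proof.
move=> hS; elim/int_rec => // n IHn; first by rewrite -addn1 PoszD hS.
by rewrite -hS -addn1 PoszD opprD subrK.
Qed.

Theorem mainTheorem1 (R : realType) (f : int * int -> R)
    (f_range : forall i j : int, 0 <= f (i, j) <= 1)
    (f_mean : forall i j : int,
       f (i, j) = 4^-1 * (f (i - 1, j) + f (i + 1, j)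
                          + f (i, j - 1) + f (i, j + 1))) :
  exists c : R, forall i j : int, f (i, j) = c.
Proof.
exists (f (0, 0)) => i j.
have -> : f (i, j) = f (0, j).
  apply: (int_shift_invariant (h := fun k => f (k, j))) => k.
  exact: harmonic_horizontal.
apply: (int_shift_invariant (h := fun k => f (0, k))) => k.
(* Vertical steps of [f] are horizontal steps of its transpose, whose mean value property only
   reorders the four neighbours. *)
apply: (@harmonic_horizontal R (fun p => f (p.2, p.1))) => // {}i {}j /=.
by rewrite [in LHS]f_mean; lra.
Qed.
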